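(* Let $E\subset\mathbb{F}_q^d$, $d\ge4$, with $\Lambda_4(E)\ll|E|^2$. If $|E|\ge Cq^{\frac d4+1}$, where $C$ is a constant, then $|\Delta(E)|\gg q$.
   Context: $\mathbb{F}_q$ is a finite field with $q$ elements; for $\mathbf{x}\in\mathbb{F}_q^d$, $\|\mathbf{x}\|=x_1^2+\cdots+x_d^2$; $\Delta(E)=\{\|\mathbf{x}-\mathbf{y}\|:\mathbf{x},\mathbf{y}\in E\}$. The additive energy $\Lambda_4(E)$ is the number of quadruples $(\mathbf{x}_1,\mathbf{x}_2,\mathbf{x}_3,\mathbf{x}_4)\in E^4$ with $\mathbf{x}_1+\mathbf{x}_2=\mathbf{x}_3+\mathbf{x}_4$. The notation $A\ll B$ (equivalently $B\gg A$) means that there is an absolute constant $C'>0$ such that $A\le C'B$.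
   Formalization: The field size q is assumed odd: for even q, ||x|| = (x_1+...+x_d)^2, and for d = 8 a large Sidon set in the hyperplane x_1+...+x_d = 0 has additive energy at most 3|E|^2 but only one distance, so the claim as stated fails. *)

(* Defs.v *)
From mathcomp Require Import all_boot all_order all_algebra.
From mathcomp Require Import reals exp.

Set Implicit Arguments.
Unset Strict Implicit.
Unset Printing Implicit Defensive.

Import Order.TTheory GRing.Theory Num.Theory.
Local Open Scope ring_scope.

(* Despite its name in the literature, this is a quadratic form, not a norm. *)
Definition qnorm (F : finFieldType) (d : nat) (x : 'rV[F]_d) : F :=
  \sum_(i < d) x 0 i ^+ 2.

Definition distance_set (F : finFieldType) (d : nat) (E : {set 'rV[F]_d}) :
    {set F} :=
  [set qnorm (x - y) | x in E, y in E].

(* The quadruple (x1, x2, x3, x4) is encoded as ((x1, x2), (x3, x4)). *)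
Definition additive_energy (F : finFieldType) (d : nat)
    (E : {set 'rV[F]_d}) : nat :=
  #|[set t in setX (setX E E) (setX E E) |
      t.1.1 + t.1.2 == t.2.1 + t.2.2]|.

(* Main.v *)
Require Import Defs.
From mathcomp Require Import all_boot all_order all_algebra.
From mathcomp Require Import all_fingroup all_solvable all_character.
From mathcomp Require Import all_field.
From mathcomp Require Import reals exp.
From mathcomp Require Import ring lra.

Set Implicit Arguments.
Unset Strict Implicit.
Unset Printing Implicit Defensive.

Import Order.TTheory GRing.Theory Num.Theory.
Local Open Scope ring_scope.

(* Let nu(t) be the number of pairs in E x E at distance t, psi a nontrivial
   additive character of F and S(s) the sum of psi(s ||x - y||) over E x E.
   By Cauchy-Schwarz |E|^4 <= |Delta(E)| sum_t nu(t)^2, and by Parseval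
   q sum_t nu(t)^2 = |E|^4 + sum_(s != 0) |S(s)|^2.  Expanding the quadratic
   form turns S(s) into a bilinear sum of a(x) a(y) psi(-2 s x.y) with |a| = 1.
   Two applications of Cauchy-Schwarz replace each of x and y by a difference
   of two elements of E, at the cost of |S|^4 <= |E|^4 Q with
   Q = sum_(u, v) r(u) r(v) psi(-2 s u.v), r(v) the number of representations
   of v as such a difference; since sum_v r(v)^2 is the additive energy L, a
   last Cauchy-Schwarz and Parseval on F^d give Q^2 <= q^d L^2.  Hence
   q sum_t nu(t)^2 <= |E|^4 + q q^(d/4) |E|^2 L^(1/2), and the second term is
   O(|E|^4) when L = O(|E|^2) and |E| >= C q^(d/4 + 1). *)

(** * Cauchy-Schwarz, Parseval and counting by fibers *)

Lemma CauchySchwarz_sum (R : numDomainType) (I : finType) (P : pred I)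
    (a b : I -> R) :
  `|\sum_(i | P i) a i * b i| ^+ 2
    <= (\sum_(i | P i) `|a i| ^+ 2) * (\sum_(i | P i) `|b i| ^+ 2).
Proof.
apply: (@le_trans _ _ ((\sum_(i | P i) `|a i| * `|b i|) ^+ 2)).
  rewrite lerXn2r ?nnegrE ?sumr_ge0 // => [i _|].
    by rewrite mulr_ge0.
  apply: le_trans (ler_norm_sum _ _ _) _.
  by apply: ler_sum => i _; rewrite normrM.
(* Lagrange's identity: twice the defect is a double sum of squares. Doubling avoids ordering the
   indices. *)
rewrite -subr_ge0 -(pmulrn_lge0 _ (ltn0Sn 1)).
suff -> : ((\sum_(i | P i) `|a i| ^+ 2) * (\sum_(i | P i) `|b i| ^+ 2)
    - (\sum_(i | P i) `|a i| * `|b i|) ^+ 2) *+ 2 =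
    \sum_(i | P i) \sum_(j | P j) (`|a i| * `|b j| - `|a j| * `|b i|) ^+ 2.
  apply: sumr_ge0 => i _; apply: sumr_ge0 => j _.
  by rewrite real_exprn_even_ge0 // rpredB // rpredM // normr_real.
rewrite mulrnBl [X in X - _]mulr2n {2}[(\sum_(i | P i) _) * _]mulrC.
rewrite expr2 !big_distrlr /= -sumrMnl -big_split -sumrB /=.
apply: eq_bigr => i _; rewrite -sumrMnl -big_split -sumrB /=.
by apply: eq_bigr => j _; ring.
Qed.

Lemma Parseval (C : numClosedFieldType) (I J : finType) (e : J -> I -> C)
    (N : C) (f : I -> C) :
    (forall i i', \sum_j e j i * (e j i')^* = N *+ (i == i')) ->
  \sum_j `|\sum_i f i * e j i| ^+ 2 = N * \sum_i `|f i| ^+ 2.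
Proof.
move=> orth.
under eq_bigr => j _.
  rewrite normCK rmorph_sum big_distrlr /=.
  under eq_bigr do under eq_bigr do rewrite rmorphM mulrACA /=.
  over.
rewrite exchange_big mulr_sumr /=; apply: eq_bigr => i _.
rewrite exchange_big (bigD1 i) //= -mulr_sumr orth eqxx normCK mulrC.
rewrite big1 ?addr0 // => i' ne_i'i; rewrite -mulr_sumr orth eq_sym.
by rewrite (negPf ne_i'i) mulr0.
Qed.

Definition fiber (I J : finType) (A : {set I}) (h : I -> J) (j : J) : nat :=
  #|[set i in A | h i == j]|.

Lemma sum_fiber (R : pzRingType) (I J : finType) (A : {set I}) (h : I -> J)
    (g : J -> R) :
  \sum_(i in A) g (h i) = \sum_j (fiber A h j)%:R * g j.
Proof.
rewrite (partition_big h xpredT) //=; apply: eq_bigr => j _.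
under eq_bigr => i /andP[_ /eqP->] do over.
by rewrite sumr_const mulr_natl /fiber cardsE.
Qed.

Lemma sum_fiber_sqr (I J : finType) (A : {set I}) (h : I -> J) :
  (\sum_j fiber A h j ^ 2 = #|[set p in setX A A | h p.1 == h p.2]|)%N.
Proof.
rewrite -sum1dep_card (partition_big (fun p => h p.1) xpredT) //=.
apply: eq_bigr => j _; rewrite -mulnn /fiber -cardsX -sum1_card.
apply: eq_bigl => -[i i']; rewrite !inE /=.
case: (i \in A); case: (i' \in A); rewrite ?andbF //= andbC.
by case: (h i =P j) => [->|_]; rewrite ?andbF ?andbT // eq_sym.
Qed.

(** * Additive characters and pairings of finite abelian groups *)

Definition additive_character (V : zmodType) (psi : V -> algC) : Prop :=
  {morph psi : x y / x + y >-> x * y} /\ forall x, `|psi x| = 1.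

Lemma additive_characterB (V : zmodType) (psi : V -> algC) (x y : V) :
  additive_character psi -> psi (x - y) = psi x * (psi y)^*.
Proof.
case=> psiD psi1; have /eqP := psi1 y.
rewrite -(eqrXn2 (ltn0Sn 1)) // normCK expr1n => /eqP yy.
by rewrite -[in RHS](subrK y x) [in RHS]psiD -mulrA yy mulr1.
Qed.

(** Translation by [x0] multiplies the sum by [psi x0], which differs from 1. *)
Lemma sum_additive_character (V : finZmodType) (psi : V -> algC) (x0 : V) :
  additive_character psi -> psi x0 != 1 -> \sum_x psi x = 0.
Proof.
case=> psiD _ ntx0; apply/eqP.
have: \sum_x psi x == psi x0 * \sum_x psi x.
  rewrite mulr_sumr (reindex_inj (addrI x0)) /=; apply/eqP.
  by apply: eq_bigr => x _; rewrite psiD.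
by rewrite -subr_eq0 -{1}[\sum_x _]mul1r -mulrBl mulf_eq0 subr_eq0 eq_sym
  (negPf ntx0).
Qed.

Lemma exists_additive_character (V : finZmodType) :
    (1 < #|V|)%N ->
  exists2 psi : V -> algC, additive_character psi & exists x, psi x != 1.
Proof.
move=> V_gt1; have cVV : abelian [set: V].
  by apply/centsP => x _ y _; apply: FinRing.zmod_mulgC.
have lt1N : (1 < Nirr [set: V])%N.
  by rewrite NirrE (eqP (etrans (esym (card_classes_abelian _)) cVV)) cardsT.
(* An abelian group has as many irreducible characters as elements, all linear, and only index 0 is
   the trivial one; so [ord_max] serves. *)
pose i : Iirr [set: V] := ord_max; have nt_i : i != 0 by rewrite -val_eqE -lt0n.
have /char_abelianP/(_ i) lin_i := cVV.
exists 'chi_i; first split=> [x y|x].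
- by rewrite -FinRing.zmodMgE (lin_charM lin_i) ?inE.
- by rewrite (normC_lin_char lin_i) ?inE.
have [x nt_x | chi1] := pickP (fun x : V => 'chi_i x != 1); first by exists x.
case/negP: nt_i; rewrite -irr_eq1; apply/eqP/cfunP => x; rewrite cfun1E inE.
by apply/eqP; have /negbFE := chi1 x.
Qed.

(* Nondegeneracy on one side suffices: an injection of V into its dual is
   bijective, the two groups having the same order. *)
Definition perfect_pairing (V : finZmodType) (e : V -> V -> algC) : Prop :=
  [/\ forall y, additive_character (e^~ y), forall x, additive_character (e x)
    & forall y, y != 0 -> exists x, e x y != 1].

(** Orthogonality: [e x y * (e x y')^*] is [e x (y - y')], a nontrivial character in [x] unless
    [y = y']. *)
Lemma Parseval_pairing (V : finZmodType) (e : V -> V -> algC) (f : V -> algC) :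
    perfect_pairing e ->
  \sum_x `|\sum_y f y * e x y| ^+ 2 = #|V|%:R * \sum_y `|f y| ^+ 2.
Proof.
case=> ecl ecr nd; apply: Parseval => y y'.
under eq_bigr => x _ do rewrite -additive_characterB //.
case: (eqVneq y y') => [<-|ney].
  under eq_bigr => x _ do
    rewrite additive_characterB // -normCK (ecr x).2 expr1n.
  by rewrite sumr_const mulr1n.
have [|x0 ntx0] := nd (y - y'); first by rewrite subr_eq0.
by rewrite mulr0n; apply: (sum_additive_character (ecl _) ntx0).
Qed.

Lemma big_setX (R : nmodType) (I J : finType) (A : {set I}) (B : {set J})
    (f : I -> J -> R) :
  \sum_(p in setX A B) f p.1 p.2 = \sum_(i in A) \sum_(j in B) f i j.
Proof.
by rewrite pair_big /=; apply: eq_bigl => -[i j]; rewrite in_setX.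
Qed.

(** * Bilinear character sums over a set *)

Definition diff_count (V : finZmodType) (E : {set V}) : V -> nat :=
  fiber (setX E E) (fun p => p.1 - p.2).

(** The eighth power comes from three successive squarings: [TP] removes [a], [PQ] removes [b], and
    [QL] brings in the energy. *)
Lemma bilinear_sum_bound (V : finZmodType) (e : V -> V -> algC) (E : {set V})
    (a b : V -> algC) :
    perfect_pairing e -> (forall x, `|a x| = 1) -> (forall y, `|b y| = 1) ->
  `|\sum_(x in E) \sum_(y in E) a x * b y * e x y| ^+ 8
    <= #|E|%:R ^+ 8 * #|V|%:R *
       (\sum_v diff_count E v ^ 2)%:R ^+ 2.
Proof.
move=> pe a1 b1; have [ecl ecr _] := pe.
set r := diff_count E; set L : algC := (\sum_v _)%:R; set T := \sum_(x in E) _.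
pose H v := \sum_(x in E) e x v.
pose P := \sum_(x in E) `|\sum_(y in E) b y * e x y| ^+ 2.
pose Q := \sum_v (r v)%:R * `|H v| ^+ 2.
have P_ge0 : 0 <= P by apply: sumr_ge0 => x _; rewrite exprn_ge0.
have Q_ge0 : 0 <= Q.
  by apply: sumr_ge0 => x _; rewrite mulr_ge0 // exprn_ge0.
have TP : `|T| ^+ 2 <= #|E|%:R * P.
  have -> : T = \sum_(x in E) a x * \sum_(y in E) b y * e x y.
    apply: eq_bigr => x _; rewrite mulr_sumr.
    by apply: eq_bigr => y _; rewrite mulrA.
  apply: le_trans (CauchySchwarz_sum _ _ _) _; rewrite -/P.
  by under eq_bigr do rewrite a1 expr1n; rewrite sumr_const.
have PQ : P ^+ 2 <= #|E|%:R ^+ 2 * Q.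
  rewrite -[leLHS]ger0_norm ?exprn_ge0 // normrX.
  (* Expanding the square and summing over [x] first leaves a function of the difference, with
     unimodular weights. *)
  have -> : P = \sum_(p in setX E E) (b p.1 * (b p.2)^*) * H (p.1 - p.2).
    rewrite (big_setX _ _ (fun y y' => b y * (b y')^* * H (y - y'))) /P.
    under eq_bigr => x _.
      rewrite normCK rmorph_sum big_distrlr /=.
      under eq_bigr do under eq_bigr do
        rewrite rmorphM mulrACA -(additive_characterB _ _ (ecr x)) /=.
      over.
    rewrite exchange_big; apply: eq_bigr => y _.
    by rewrite exchange_big; apply: eq_bigr => y' _; rewrite -mulr_sumr.
  apply: le_trans (CauchySchwarz_sum _ _ _) _.
  under eq_bigr do rewrite normrM norm_conjC !b1 mulr1 expr1n.
  rewrite sumr_const cardsX natrM.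
  by rewrite (sum_fiber _ (fun p : V * V => p.1 - p.2) (fun v => `|H v| ^+ 2)).
have QL : Q ^+ 2 <= #|V|%:R * L ^+ 2.
  have L_E : L = \sum_v `|(r v)%:R| ^+ 2.
    by rewrite /L natr_sum; apply: eq_bigr => v _; rewrite normr_nat -natrX.
  rewrite -[leLHS]ger0_norm ?exprn_ge0 // normrX.
  (* Expanding [|H v|^2] produces differences in the first slot as well. *)
  have -> : Q = \sum_u (r u)%:R * \sum_v (r v)%:R * e u v.
    under [RHS]eq_bigr => u _ do rewrite mulr_sumr.
    rewrite exchange_big; apply: eq_bigr => v _.
    under [RHS]eq_bigr => u _ do rewrite mulrCA.
    rewrite -mulr_sumr; congr (_ * _).
    rewrite -(sum_fiber _ (fun p : V * V => p.1 - p.2) (e^~ v)).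
    rewrite (big_setX _ _ (fun x x' => e (x - x') v)) normCK rmorph_sum.
    rewrite big_distrlr /=; apply: eq_bigr => x _; apply: eq_bigr => x' _.
    by rewrite (additive_characterB _ _ (ecl v)).
  apply: le_trans (CauchySchwarz_sum _ _ _) _.
  by rewrite Parseval_pairing // -L_E mulrCA.
have TQ : `|T| ^+ 4 <= #|E|%:R ^+ 4 * Q.
  rewrite (exprM _ 2 2) (exprD _ 2 2) -mulrA.
  apply: le_trans (lerXn2r 2 _ _ TP) _; rewrite ?nnegrE ?mulr_ge0 ?exprn_ge0 //.
  by rewrite exprMn ler_wpM2l ?exprn_ge0.
rewrite (exprM _ 4 2) (exprM _ 4 2) -mulrA.
apply: le_trans (lerXn2r 2 _ _ TQ) _; rewrite ?nnegrE ?mulr_ge0 ?exprn_ge0 //.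
by rewrite exprMn ler_wpM2l ?exprn_ge0.
Qed.

(** * Pairings and the quadratic form over a finite field of odd order *)

Lemma odd_card_natr2_neq0 (F : finFieldType) : odd #|F| -> 2%:R != 0 :> F.
Proof.
move=> oddF; apply/eqP => F2.
have : (1 : F) *+ #|F| = 0.
  by have := expg_cardG (in_setT (1 : F)); rewrite FinRing.zmodXgE cardsT.
rewrite -[#|F|]odd_double_half oddF mulrnDr -muln2 mulnC mulrnA F2 mul0rn.
by rewrite addr0; apply/eqP/oner_neq0.
Qed.

Lemma mul_perfect_pairing (F : finFieldType) (psi : F -> algC) :
    additive_character psi -> (exists x, psi x != 1) ->
  perfect_pairing (fun s t => psi (s * t)).
Proof.
move=> [psiD psi1] [x0 ntx0]; split=> [t|s|t nzt].
- by split=> [x y|x]; rewrite ?mulrDl ?psiD ?psi1.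
- by split=> [x y|x]; rewrite ?mulrDr ?psiD ?psi1.
- by exists (x0 / t); rewrite divfK.
Qed.

Lemma dot_perfect_pairing (F : finFieldType) (d : nat) (psi : F -> algC)
    (c : F) :
    additive_character psi -> (exists x, psi x != 1) -> c != 0 ->
  perfect_pairing (fun u v : 'rV[F]_d => psi (c * (u *m v^T) 0 0)).
Proof.
move=> [psiD psi1] [x0 ntx0] nzc; split=> [v|u|v nzv].
- by split=> [x y|x]; rewrite ?mulmxDl ?mxE ?mulrDr ?psiD ?psi1.
- by split=> [x y|x]; rewrite ?linearD ?mxE ?mulrDr ?psiD ?psi1.
have /rV0Pn[k nzk] := nzv.
(* This multiple of a basis vector makes the argument of [psi] equal to [x0]. *)
exists ((x0 / (c * v 0 k)) *: delta_mx 0 k).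
rewrite -scalemxAl -rowE !mxE.
suff -> : c * (x0 / (c * v 0 k) * v 0 k) = x0 by [].
by field; apply/andP; split.
Qed.

Lemma qnormB (F : finFieldType) (d : nat) (x y : 'rV[F]_d) :
  qnorm (x - y) = qnorm x + qnorm y - 2%:R * (x *m y^T) 0 0.
Proof.
rewrite /qnorm mxE mulr_sumr -big_split -sumrB /=.
by apply: eq_bigr => i _; rewrite !mxE; ring.
Qed.

Lemma sum_diff_count_sqr (F : finFieldType) (d : nat) (E : {set 'rV[F]_d}) :
  (\sum_v diff_count E v ^ 2)%N = additive_energy E.
Proof.
rewrite sum_fiber_sqr /additive_energy.
(* Exchanging the second entries of the two pairs turns equal differences into equal sums. *)
pose f (t : ('rV[F]_d * 'rV[F]_d) * ('rV[F]_d * 'rV[F]_d)) :=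
  ((t.1.1, t.2.2), (t.2.1, t.1.2)).
have fK : involutive f by case=> -[? ?] [? ?].
rewrite -(card_imset _ (inv_inj fK)); apply: eq_card => t.
rewrite -[t]fK mem_imset; last exact: inv_inj.
case: t => -[x y] [z w]; rewrite !inE /=; congr (_ && _).
  by do 4!case: (_ \in E).
by rewrite subr_eq addrAC eq_sym subr_eq eq_sym.
Qed.

(** * Distance counts and their second moment *)

Definition distance_count (F : finFieldType) (d : nat) (E : {set 'rV[F]_d}) :
    F -> nat :=
  fiber (setX E E) (fun p => qnorm (p.1 - p.2)).

(** The factors [psi (s * qnorm x)] and [psi (s * qnorm y)] serve as unimodular weights; the cross
    term gives a pairing with scalar [-2s], nonzero in odd characteristic. *)
Lemma distance_exp_sum_bound (F : finFieldType) (d : nat) (E : {set 'rV[F]_d})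
    (psi : F -> algC) (s : F) :
    odd #|F| -> additive_character psi -> (exists x, psi x != 1) -> s != 0 ->
  `|\sum_t (distance_count E t)%:R * psi (s * t)| ^+ 8
    <= (#|E| ^ 8 * #|F| ^ d * additive_energy E ^ 2)%:R.
Proof.
move=> oddF psiP nt nzs; have [psiD psi1] := psiP.
have nz2s : - (s * 2%:R) != 0.
  by rewrite oppr_eq0 mulf_neq0 // odd_card_natr2_neq0.
rewrite -(sum_fiber _ (fun p => qnorm (p.1 - p.2)) (fun t => psi (s * t))).
rewrite (big_setX _ _ (fun x y => psi (s * qnorm (x - y)))).
under eq_bigr do under eq_bigr do
  rewrite qnormB !mulrDr mulrN mulrA -mulNr !psiD.
apply: le_trans (bilinear_sum_bound _ (dot_perfect_pairing d psiP nt nz2s) _ _)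
  _ => //; rewrite sum_diff_count_sqr card_mx mul1n.
by rewrite !natrM !natrX.
Qed.

(* Truncated subtraction is harmless: the difference is the nonnegative sum of
   the |S(s)|^2 over s != 0. *)
Lemma distance_count_variance (F : finFieldType) (d : nat)
    (E : {set 'rV[F]_d}) :
    odd #|F| ->
  ((#|F| * (\sum_t distance_count E t ^ 2) - #|E| ^ 4) ^ 4
    <= #|F| ^ (d + 4) * #|E| ^ 8 * additive_energy E ^ 2)%N.
Proof.
move=> oddF.
have [psi psiP nt] := exists_additive_character (finNzRing_gt1 F).
pose S s := \sum_t (distance_count E t)%:R * psi (s * t).
set A := (#|E| ^ 8 * #|F| ^ d * additive_energy E ^ 2)%N.
set N := (\sum_t _)%N.
(* The bound on [|S s|^8] becomes one on [|S s|^2], which can be summed over [s]; a final fourth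
   power removes the root. *)
pose B : algC := 4.-root A%:R.
have B_ge0 : 0 <= B by rewrite rootC_ge0.
have psi0 : psi 0 = 1.
  rewrite -(subrr 0) (additive_characterB _ _ psiP) -normCK psiP.2.
  by rewrite expr1n.
have S0 : S 0 = (#|E| ^ 2)%:R.
  rewrite /S -(sum_fiber _ (fun p => qnorm (p.1 - p.2)) (fun t => psi (0 * t))).
  under eq_bigr do rewrite mul0r psi0.
  by rewrite sumr_const cardsX mulnn.
have SB s : s != 0 -> `|S s| ^+ 2 <= B.
  move=> nzs; rewrite -(ler_pXn2r (ltn0Sn 3)) ?nnegrE ?exprn_ge0 //.
  rewrite rootCK // -exprM.
  exact: distance_exp_sum_bound.
have FN : (#|F| * N)%:R = (#|E| ^ 4)%:R + \sum_(s | s != 0) `|S s| ^+ 2.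
  have := Parseval_pairing (fun t => (distance_count E t)%:R)
    (mul_perfect_pairing psiP nt).
  rewrite (bigD1 0) //= -/(S 0) S0 normr_nat -natrX -expnM => ->.
  rewrite natrM natr_sum; congr (_ * _).
  by apply: eq_bigr => t _; rewrite normr_nat natrX.
have FN_ge : (#|E| ^ 4 <= #|F| * N)%N.
  by rewrite -(ler_nat algC) FN lerDl sumr_ge0 // => s _; rewrite exprn_ge0.
have XB : (#|F| * N - #|E| ^ 4)%:R <= #|F|%:R * B.
  rewrite natrB // FN addrC addKr.
  apply: le_trans (ler_sum _ SB) _.
  rewrite sumr_const mulr_natl ler_wpMn2l //.
  exact: max_card.
rewrite -(ler_nat algC) natrX.
apply: le_trans (lerXn2r 4 _ _ XB) _; rewrite ?nnegrE ?mulr_ge0 //.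
rewrite exprMn rootCK // -natrX -natrM ler_nat /A.
by rewrite expnD; apply: eq_leq; ring.
Qed.

(** The counts are supported on the distance set and have total [|E|^2]; Cauchy-Schwarz is applied
    against the constant 1 on that support. *)
Lemma distance_set_CauchySchwarz (F : finFieldType) (d : nat)
    (E : {set 'rV[F]_d}) :
  (#|E| ^ 4 <= #|distance_set E| * \sum_t distance_count E t ^ 2)%N.
Proof.
have count0 t : t \notin distance_set E -> distance_count E t = 0%N.
  move=> Dt; apply/eqP; rewrite cards_eq0; apply/eqP/setP => -[x y].
  rewrite !inE /=; apply: contraNF Dt => /andP[/andP[Ex Ey] /eqP <-].
  exact: imset2_f.
have E2 : \sum_(t in distance_set E) (distance_count E t)%:R
    = (#|E| ^ 2)%:R :> int.
  have := sum_fiber (setX E E) (fun p => qnorm (p.1 - p.2)) (fun=> 1 : int).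
  rewrite sumr_const cardsX mulnn => ->; rewrite big_mkcond /=.
  by apply: eq_bigr => t _; case: ifPn => [_|/count0 Dt];
    rewrite ?mulr1 // -/(distance_count E t) Dt.
rewrite -(ler_nat int) (expnM _ 2 2) natrX -E2 natrM.
have /= := CauchySchwarz_sum (mem (distance_set E)) (fun=> 1 : int)
  (fun t => (distance_count E t)%:R).
under eq_bigr do rewrite mul1r.
rewrite ger0_norm ?sumr_ge0 //.
under [X in X * _]eq_bigr do rewrite normr1 expr1n.
rewrite sumr_const => /le_trans; apply; rewrite ler_wpM2l // natr_sum.
rewrite [leLHS]big_mkcond; apply: ler_sum => t _.
by case: ifP => _; rewrite ?normr_nat -?natrX.
Qed.

Theorem corollary7 (R : realType) (K C : R) (hK : 0 < K) (hC : 0 < C) :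
  exists2 c : R, 0 < c &
    forall (F : finFieldType) (d : nat) (E : {set 'rV[F]_d}),
      odd #|F| ->
      (4 <= d)%N ->
      (additive_energy E)%:R <= K * #|E|%:R ^+ 2 ->
      C * (#|F|%:R `^ (d%:R / 4 + 1)) <= #|E|%:R ->
      c * #|F|%:R <= #|distance_set E|%:R.
Proof.
pose k := Num.sqrt K; have k_gt0 : 0 < k by rewrite sqrtr_gt0.
(* With [X] the excess of [q N] over [n^4], [XC] gives [q N <= (1 + k / C) n^4], and [n^4 <= D N]
   then yields this constant. *)
exists (C / (C + k)) => [|F d E oddF _ hL hE].
  by rewrite divr_gt0 // addr_gt0.
have q_gt0 : 0 < #|F|%:R :> R by rewrite ltr0n (ltn_trans _ (finNzRing_gt1 F)).
have n_gt0 : 0 < #|E|%:R :> R.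
  by apply: lt_le_trans hE; rewrite mulr_gt0 // powR_gt0.
have hn : C ^+ 4 * #|F|%:R ^+ (d + 4) <= #|E|%:R ^+ 4 :> R.
  have -> : #|F|%:R ^+ (d + 4) = (#|F|%:R `^ (d%:R / 4 + 1)) ^+ 4 :> R.
    rewrite -[RHS]powR_mulrn ?powR_ge0 // -powRrM -[LHS]powR_mulrn ?ltW //.
    by congr (_ `^ _); rewrite natrD; field.
  by rewrite -exprMn lerXn2r ?nnegrE ?mulr_ge0 ?powR_ge0 // ltW.
have := distance_count_variance E oddF.
have := distance_set_CauchySchwarz E.
set N := (\sum_t _)%N; set D := #|distance_set E|; set q := #|F|.
set X := (q * N - _)%N; set L := additive_energy E; set n := #|E|.
rewrite -(ler_nat R) natrX natrM => hDN.
rewrite -(ler_nat R) natrX 2!natrM !natrX => hX.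
have hqN : q%:R * N%:R <= n%:R ^+ 4 + X%:R :> R.
  by rewrite -natrM -natrX -natrD ler_nat -leq_subLR.
have C_ge0 := ltW hC; have k_ge0 := ltW k_gt0; have K_ge0 := ltW hK.
(* Fourth powers are compared: the size hypothesis absorbs [C^4 q^(d+4)] into [n^4], the energy
   hypothesis bounds [L^2] by [K^2 n^4], and [k^4 = K^2]. *)
have XC : C * X%:R <= k * n%:R ^+ 4.
  rewrite -(ler_pXn2r (ltn0Sn 3)) ?nnegrE ?mulr_ge0 ?exprn_ge0 // [leLHS]exprMn.
  apply: (@le_trans _ _ (C ^+ 4 * (q%:R ^+ (d + 4) * n%:R ^+ 8 * L%:R ^+ 2))).
    by rewrite ler_wpM2l ?exprn_ge0.
  have -> : (k * n%:R ^+ 4) ^+ 4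
      = n%:R ^+ 4 * (n%:R ^+ 8 * (K * n%:R ^+ 2) ^+ 2) :> R.
    by rewrite exprMn (exprM k 2 2) sqr_sqrtr //; ring.
  rewrite -mulrA mulrA; apply: ler_pM => //.
  - by rewrite mulr_ge0 ?exprn_ge0.
  - by rewrite mulr_ge0 ?exprn_ge0.
  - rewrite ler_wpM2l ?exprn_ge0 // lerXn2r ?nnegrE //.
    by rewrite mulr_ge0 ?exprn_ge0.
rewrite mulrAC ler_pdivrMr ?addr_gt0 //.
(* After scaling by [n^4], the chain is [C q n^4 <= C D q N <= C D (n^4 + X) <= D (C + k) n^4]. *)
have n4_gt0 : 0 < n%:R ^+ 4 :> R by rewrite exprn_gt0.
rewrite -(ler_pM2l n4_gt0).
have h1 : C * q%:R * n%:R ^+ 4 <= C * q%:R * (D%:R * N%:R).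
  by rewrite ler_wpM2l ?mulr_ge0.
have h2 : C * D%:R * (q%:R * N%:R) <= C * D%:R * (n%:R ^+ 4 + X%:R).
  by rewrite ler_wpM2l ?mulr_ge0.
have h3 : D%:R * (C * X%:R) <= D%:R * (k * n%:R ^+ 4) by rewrite ler_wpM2l.
lra.
Qed.
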